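(* (a) For integers $s\ge0$ and $n\ge1$, the Ramanujan polynomial satisfies $$[1-(-1)^n]R_{2s+1}^{(n)}(1)+\sum_{j=1}^{n-1}\binom nj\left[\frac{(n-1)!}{(j-1)!}-(-1)^j(2s+2)_{n-j}\right]R_{2s+1}^{(j)}(1)=(2s+2)_nR_{2s+1}(1).$$ (b) For integers $s\ge1$ and $n\ge1$, with $R_{2s}=Q_{2s}$ and $T(z)=R_{2s}(z)-R_{2s}(z/2)$ (so $T^{(j)}(1)=R_{2s}^{(j)}(1)-2^{-j}R_{2s}^{(j)}(1/2)$), $$[1-(-1)^n]T^{(n)}(1)+\sum_{j=1}^{n-1}\binom nj\left[\frac{(n-1)!}{(j-1)!}-(-1)^j(2s+2)_{n-j}\right]T^{(j)}(1)=(2s+2)_n\,T(1).$$ (c) Let $r$ be real, $\delta$ an integer, $F$ analytic on the upper half plane $\mathbb H$ and $S$ analytic on the right half plane, and suppose that for all $z\in\mathbb H$ $$F\!\left(-\frac1z\right)-(-1)^\delta\left(\frac zi\right)^rF(z)=S\!\left(\frac zi\right)$$ (principal branch of the power). Then for every integer $n\ge1$, $$[(-1)^n-(-1)^\delta]F^{(n)}(i)-(-1)^\delta(-r)_n\,i^nF(i)+\sum_{j=1}^{n-1}\binom nj\left[(-1)^n\frac{(n-1)!}{(j-1)!}-(-1)^\delta(-1)^{n-j}(-r)_{n-j}\right]i^{j-n}F^{(j)}(i)=\frac{1}{i^n}S^{(n)}(1).$$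
   Context: $B_n$ are the Bernoulli numbers ($x/(e^x-1)=\sum B_nx^n/n!$). Define $B_0^*=1$, $B_1^*=1/4$ and for $s\ge2$, $B_s^*=-\frac{1}{s+1}\sum_{k=0}^{s-1}\binom{s+1}{k}2^{k-s}B_k$. The Ramanujan polynomials are $R_{2s+1}(z)=\sum_{k=0}^{s+1}\frac{B_{2k}B_{2s+2-2k}}{(2k)!(2s+2-2k)!}z^{2k}$, and the generalized Ramanujan polynomials are $Q_r(z)=\sum_{k=0}^{\lfloor (r+1)/2\rfloor}\frac{B^*_{r+1-2k}B^*_{2k}}{(r+1-2k)!(2k)!}z^{2k}$. $(a)_j=\Gamma(a+j)/\Gamma(a)$ is the Pochhammer symbol, and $f^{(j)}$ denotes the $j$-th derivative. *)

(* Defs.v *)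
From Stdlib Require Import Reals ZArith.
From HB Require Import structures.
From mathcomp Require Import all_boot all_order all_algebra.
Set Implicit Arguments. Unset Strict Implicit. Unset Printing Implicit Defensive.
Import Order.TTheory GRing.Theory Num.Theory.

Section Rational.
Local Open Scope ring_scope.

(* bernl n = [:: B_0; ...; B_n], via the standard recurrence
   B_0 = 1,  B_m = -1/(m+1) * sum_{k<m} C(m+1,k) B_k,
   which characterises x/(e^x-1) = sum B_n x^n/n!  (so B_1 = -1/2). *)
Fixpoint bernl (n : nat) : seq rat :=
  match n with
  | 0%N => [:: 1]
  | m.+1 => let l := bernl m in
      rcons l (- ((m.+2)%:R)^-1 * \sum_(k < m.+1) ('C(m.+2, k))%:R * l`_k)
  end.

Definition bern (n : nat) : rat := (bernl n)`_n.

Definition bstar (s : nat) : rat :=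
  match s with
  | 0%N => 1
  | 1%N => (4%:R)^-1
  | _ => - ((s.+1)%:R)^-1 *
         \sum_(k < s) ('C(s.+1, k))%:R * (2%:R ^+ (s - k))^-1 * bern k
  end.

Definition ramanujanR (s : nat) : {poly rat} :=
  \sum_(k < s.+2)
    (bern (2 * k)%N * bern (2 * s + 2 - 2 * k)%N
      / (((2 * k)`!)%:R * ((2 * s + 2 - 2 * k)`!)%:R)) *: 'X^(2 * k).

Definition genQ (r : nat) : {poly rat} :=
  \sum_(k < (r.+1)./2.+1)
    (bstar (r.+1 - 2 * k)%N * bstar (2 * k)%N
      / (((r.+1 - 2 * k)`!)%:R * ((2 * k)`!)%:R)) *: 'X^(2 * k).

Definition poch (a : rat) (m : nat) : rat := \prod_(i < m) (a + i%:R).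

End Rational.

Section Complex.
Local Open Scope R_scope.

Definition CC : Type := (R * R)%type.
Definition RtoC (x : R) : CC := (x, 0).
Definition Cnat (n : nat) : CC := RtoC (INR n).
Definition Czero : CC := RtoC 0.
Definition Cone : CC := RtoC 1.
Definition Ci : CC := (0, 1).
Definition Cadd (z w : CC) : CC := (fst z + fst w, snd z + snd w).
Definition Cneg (z : CC) : CC := (- fst z, - snd z).
Definition Csub (z w : CC) : CC := Cadd z (Cneg w).
Definition Cmul (z w : CC) : CC :=
  (fst z * fst w - snd z * snd w, fst z * snd w + snd z * fst w).
Definition Cnorm2 (z : CC) : R := fst z * fst z + snd z * snd z.
Definition Cinv (z : CC) : CC := (fst z / Cnorm2 z, - snd z / Cnorm2 z).
Definition Cdiv (z w : CC) : CC := Cmul z (Cinv w).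
Definition Cabs (z : CC) : R := sqrt (Cnorm2 z).
Fixpoint Cpow (z : CC) (n : nat) : CC :=
  match n with O => Cone | S m => Cmul z (Cpow z m) end.

Definition Cm1powZ (d : Z) : CC := if Z.even d then Cone else Cneg Cone.

(* principal argument, in (-pi, pi] *)
Definition Carg (z : CC) : R :=
  let x := fst z in let y := snd z in
  if Rlt_dec 0 x then atan (y / x)
  else if Rlt_dec x 0 then
    (if Rle_dec 0 y then atan (y / x) + PI else atan (y / x) - PI)
  else if Rlt_dec 0 y then PI / 2
  else if Rlt_dec y 0 then - (PI / 2) else 0.

Definition Cpowr (w : CC) (r : R) : CC :=
  if Req_EM_T (Cnorm2 w) 0 then Czero
  else (exp (r * ln (Cabs w)) * cos (r * Carg w),
        exp (r * ln (Cabs w)) * sin (r * Carg w)).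

Fixpoint Cpoch (a : CC) (m : nat) : CC :=
  match m with O => Cone | S k => Cmul (Cpoch a k) (Cadd a (Cnat k)) end.

Fixpoint Csum (m : nat) (f : nat -> CC) : CC :=
  match m with O => Czero | S k => Cadd (Csum k f) (f k) end.
Definition Csum_range (a b : nat) (f : nat -> CC) : CC :=
  Csum (b - a)%nat (fun k => f (a + k)%nat).

Definition C_has_deriv (f : CC -> CC) (z l : CC) : Prop :=
  forall eps : R, 0 < eps -> exists delta : R, 0 < delta /\
    forall h : CC, h <> Czero -> Cabs h < delta ->
      Cabs (Csub (Cdiv (Csub (f (Cadd z h)) (f z)) h) l) < eps.

(* f holomorphic (= analytic) on the open set U *)
Definition holomorphic_on (U : CC -> Prop) (f : CC -> CC) : Prop :=
  forall z, U z -> exists l, C_has_deriv f z l.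

Definition deriv_seq (U : CC -> Prop) (f : CC -> CC) (D : nat -> CC -> CC) : Prop :=
  (forall z, U z -> D 0%nat z = f z) /\
  (forall k z, U z -> C_has_deriv (D k) z (D (S k) z)).

Definition upper_half_plane (z : CC) : Prop := 0 < snd z.
Definition right_half_plane (z : CC) : Prop := 0 < fst z.

End Complex.

Declare Scope C_scope.
Delimit Scope C_scope with C.
Infix "+" := Cadd : C_scope.
Infix "-" := Csub : C_scope.
Infix "*" := Cmul : C_scope.
Infix "/" := Cdiv : C_scope.
Notation "- x" := (Cneg x) : C_scope.
Infix "^" := Cpow : C_scope.

(* Main.v *)
(* In (a) and (b), both sides are linear in the polynomial.  On [X^m] the Lah
   expansion [(m)_n = sum_j C(n,j) (n-1)!/(j-1)! m(m-1)...(m-j+1)] and the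
   Chu-Vandermonde expansion of [(N-m)_n], [N = 2s+2], show that their
   difference is [(m)_n - (N-m)_n].  This is odd under [m -> N-m], so the identity
   holds for every polynomial with [p(X) = X^N p(1/X)].  The Ramanujan
   polynomial visibly has this symmetry.  For [T], the values [B_n(1/2)] of the
   Bernoulli polynomials give, for odd [m], [B*_m = (4 - 2^(1-m)) B_(m+1)/(m+1)],
   and the coefficient of [X^(2k)] in [T] becomes [4 t_(2k) t_(N-2k)] with
   [t_m = (1 - 2^-m) B_m/m!].

   For (c), the successive derivatives of [F(-1/z)] have the Lah numbers as
   coefficients and those of [(z/i)^r F(z)] are given by the Leibniz rule;
   evaluate the [n]-th derivative of the functional equation at [z = i], a fixed
   point of [z -> -1/z]. *)
Require Import Defs.
From Stdlib Require Import Reals ZArith Lra.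
From HB Require Import structures.
From mathcomp Require Import all_boot all_order all_algebra.
From mathcomp Require Import Rstruct.
From Coquelicot Require Coquelicot.
Import GRing.Theory.

(** * The complex field *)

Section ComplexField.
Local Open Scope R_scope.

(** The algebraic structures are put on the pair type itself, so that the operations of the
    statement are convertible to the generic ones. *)
HB.instance Definition _ := Choice.copy CC (R * R)%type.

Lemma Cadd_assoc : associative Cadd.
Proof. by move=> [a b] [c d] [e f]; rewrite /Cadd /=; congr pair; ring. Qed.
Lemma Cadd_comm : commutative Cadd.
Proof. by move=> [a b] [c d]; rewrite /Cadd /=; congr pair; ring. Qed.
Lemma Cadd_0 : left_id Czero Cadd.
Proof. by move=> [a b]; rewrite /Cadd /=; congr pair; ring. Qed.
Lemma Cadd_neg : left_inverse Czero Cneg Cadd.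
Proof. by move=> [a b]; rewrite /Cadd /Czero /RtoC /=; congr pair; ring. Qed.

HB.instance Definition _ :=
  GRing.isZmodule.Build CC Cadd_assoc Cadd_comm Cadd_0 Cadd_neg.

Lemma Cmul_assoc : associative Cmul.
Proof. by move=> [a b] [c d] [e f]; rewrite /Cmul /=; congr pair; ring. Qed.
Lemma Cmul_comm : commutative Cmul.
Proof. by move=> [a b] [c d]; rewrite /Cmul /=; congr pair; ring. Qed.
Lemma Cmul_1 : left_id Cone Cmul.
Proof. by move=> [a b]; rewrite /Cmul /=; congr pair; ring. Qed.
Lemma Cmul_add : left_distributive Cmul Cadd.
Proof. by move=> [a b] [c d] [e f]; rewrite /Cmul /Cadd /=; congr pair; ring. Qed.
Lemma Cone_neq0 : (Cone : CC) != 0%R.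
Proof. by apply/eqP => -[] /R1_neq_R0. Qed.

HB.instance Definition _ := GRing.Zmodule_isComNzRing.Build CC
  Cmul_assoc Cmul_comm Cmul_1 Cmul_add Cone_neq0.

Lemma Cnorm2_gt0 (z : CC) : z <> Czero -> 0 < Cnorm2 z.
Proof.
case: z => a b nz; rewrite /Cnorm2 /=.
case: (Req_dec a 0) => [a0|a0]; last by nra.
by case: (Req_dec b 0) => [b0|b0]; [case: nz; rewrite a0 b0|nra].
Qed.

Lemma Cmul_inv (z : CC) : z != 0%R -> Cmul (Cinv z) z = Cone.
Proof.
move=> /eqP/Cnorm2_gt0; case: z => a b; rewrite /Cinv /Cnorm2 /= => P.
by rewrite /Cmul /Cone /RtoC /=; congr pair; field; lra.
Qed.
Lemma Cinv_0 : Cinv (0%R : CC) = 0%R.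
Proof. by rewrite /Cinv /=; congr pair; rewrite /Rdiv ?Ropp_0 Rmult_0_l. Qed.

HB.instance Definition _ := GRing.ComNzRing_isField.Build CC Cmul_inv Cinv_0.

Lemma CnatE (n : nat) : Cnat n = n%:R%R.
Proof.
elim: n => [//|n IHn]; rewrite -addn1 natrD -IHn /Cnat /RtoC addn1 S_INR.
by rewrite [RHS]/(Cadd _ _) /Cadd /=; congr pair; ring.
Qed.

Lemma CpowE (z : CC) (n : nat) : Cpow z n = (z ^+ n)%R.
Proof. by elim: n => //= n ->; rewrite exprS. Qed.

Lemma CsumE (n : nat) (f : nat -> CC) : Csum n f = (\sum_(i < n) f i)%R.
Proof. by elim: n => [|n IHn]; rewrite ?big_ord0 // big_ord_recr /= IHn. Qed.

Lemma CringE : (forall z w : CC, Cadd z w = (z + w)%R) *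
  (forall z w : CC, Cmul z w = (z * w)%R) * (forall z : CC, Cneg z = (- z)%R) *
  (forall z : CC, Cinv z = (z^-1)%R) * (Cone = 1%R) *
  (forall z w : CC, Csub z w = (z - w)%R) * (forall z w : CC, Cdiv z w = (z / w)%R).
Proof. by do !split. Qed.

End ComplexField.

(** * Complex derivatives *)

Section ComplexDerivative.
Import Coquelicot.Coquelicot.
Import Defs.
Local Open Scope R_scope.

Lemma CabsE (z : CC) : Cabs z = Cmod z.
Proof. by rewrite /Cabs /Cmod /Cnorm2; congr sqrt; ring. Qed.

Lemma CabsM (z w : CC) : Cabs (z * w)%R = Cabs z * Cabs w.
Proof. by rewrite !CabsE; exact: Cmod_mult. Qed.

(** Multiplying by [h] removes the quotient and admits [h = 0]; this is the form in which
    differentials are stated in Coquelicot. *)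
Lemma C_has_derivP (f : CC -> CC) (z l : CC) :
  C_has_deriv f z l <->
  (forall eps, 0 < eps -> exists2 delta, 0 < delta &
    forall h : CC, Cabs h < delta ->
      Cabs (f (z + h)%R - f z - h * l)%R <= eps * Cabs h).
Proof.
have key (h d : CC) : h <> Czero ->
    Cabs (d - h * l)%R = Cabs (Csub (Cdiv d h) l) * Cabs h.
  move=> /eqP h0; rewrite -CabsM; congr Cabs.
  by rewrite [in RHS]mulrBl -[Cdiv d h]/(d / h)%R divfK // mulrC.
split=> fd eps eps_gt0.
  have [d [d_gt0 fd']] := fd _ eps_gt0; exists d => // h h_lt.
  case: (Req_dec_T (Cnorm2 h) 0) => [n0|n0].
    have -> : h = Czero by case: (eqVneq h Czero) => // /eqP/Cnorm2_gt0; lra.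
    rewrite -[Czero]/(0%R : CC) mul0r subr0 addr0 subrr -[0%R : CC]/Czero.
    rewrite /Cabs /Cnorm2 /= !Rmult_0_l Rplus_0_l sqrt_0; lra.
  have h0 : h <> Czero by move=> h0; apply: n0; rewrite h0 /Cnorm2 /=; ring.
  rewrite key //; apply: Rmult_le_compat_r; first exact: sqrt_pos.
  exact/Rlt_le/fd'.
(* Halving [eps] turns the large inequality into the strict one of the definition. *)
have e2 : 0 < eps / 2 by lra.
have [d d_gt0 fd'] := fd _ e2; exists d; split=> // h h0 h_lt.
have P : 0 < Cabs h by apply: sqrt_lt_R0; exact: Cnorm2_gt0.
apply: (Rle_lt_trans _ (eps / 2)); last by lra.
by apply: (Rmult_le_reg_r (Cabs h)) => //; rewrite -key //; exact: fd'.
Qed.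

Lemma is_derive_C_has_deriv (f : CC -> CC) (z l : CC) :
  @is_derive C_AbsRing (AbsRing_NormedModule C_AbsRing) f z l <-> C_has_deriv f z l.
Proof.
rewrite C_has_derivP; split=> [[_ fd] eps eps_gt0|fd].
  have [d fd'] := fd z (fun P H => H) (mkposreal _ eps_gt0).
  exists d; first exact: (cond_pos d).
  move=> h h_lt; have := fd' (z + h)%R.
  have E : minus ((z + h)%R : C_AbsRing) z = h by rewrite -[LHS]/(z + h - z)%R addrC addKr.
  rewrite E; rewrite !CabsE in h_lt *; apply.
  by rewrite /ball /= /AbsRing_ball E.
split; first exact: is_linear_scal_l.
move=> x /is_filter_lim_locally_unique <- [eps eps_gt0].
have [d d_gt0 fd'] := fd _ eps_gt0; exists (mkposreal _ d_gt0) => y.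
rewrite /ball /= /AbsRing_ball => y_lt.
have := fd' (y - z)%R; rewrite !CabsE => /(_ y_lt).
by rewrite [(z + (y - z))%R]addrC subrK.
Qed.

Lemma has_deriv_uniq (f : CC -> CC) (z l m : CC) :
  C_has_deriv f z l -> C_has_deriv f z m -> l = m.
Proof.
have unique d : C_has_deriv f z d -> C_derive f z = d.
  move=> /is_derive_C_has_deriv [lin dom]; apply: is_C_derive_unique.
  by split; [exact: is_linear_scal_l|exact: dom].
by move=> /unique <- /unique <-.
Qed.

Lemma has_deriv_const (c z : CC) : C_has_deriv (fun _ => c) z 0%R.
Proof. by apply/is_derive_C_has_deriv; exact: is_derive_const. Qed.

Lemma has_deriv_id (z : CC) : C_has_deriv id z 1%R.
Proof. by apply/is_derive_C_has_deriv; exact: is_derive_id. Qed.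

Lemma has_deriv_add (f g : CC -> CC) (z l m : CC) :
  C_has_deriv f z l -> C_has_deriv g z m ->
  C_has_deriv (fun w => f w + g w)%R z (l + m)%R.
Proof.
move=> /is_derive_C_has_deriv df /is_derive_C_has_deriv dg.
by apply/is_derive_C_has_deriv; exact: is_derive_plus.
Qed.

Lemma has_deriv_mul (f g : CC -> CC) (z l m : CC) :
  C_has_deriv f z l -> C_has_deriv g z m ->
  C_has_deriv (fun w => f w * g w)%R z (l * g z + f z * m)%R.
Proof.
move=> /is_derive_C_has_deriv df /is_derive_C_has_deriv dg.
apply/is_derive_C_has_deriv; apply: (@is_derive_mult C_AbsRing) => //.
exact: Cmult_comm.
Qed.

Lemma has_deriv_comp (f g : CC -> CC) (z l m : CC) :
  C_has_deriv f (g z) l -> C_has_deriv g z m ->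
  C_has_deriv (fun w => f (g w)) z (m * l)%R.
Proof.
move=> /is_derive_C_has_deriv df /is_derive_C_has_deriv dg.
by apply/is_derive_C_has_deriv; apply: (@is_derive_comp C_AbsRing).
Qed.

Lemma has_deriv_Cmul (c : CC) (f : CC -> CC) (z l : CC) :
  C_has_deriv f z l -> C_has_deriv (fun w => c * f w)%R z (c * l)%R.
Proof.
by move=> /(has_deriv_mul _ _ z _ _ (has_deriv_const c z)); rewrite mul0r add0r.
Qed.

Lemma has_deriv_eq (f g : CC -> CC) (z l : CC) :
  f =1 g -> C_has_deriv f z l -> C_has_deriv g z l.
Proof.
move=> fg df eps eps_gt0; have [d [d_gt0 dfd]] := df eps eps_gt0.
by exists d; split=> // h; rewrite -!fg; exact: dfd.
Qed.

Lemma has_deriv_sum (n : nat) (f : 'I_n -> CC -> CC) (z : CC) (l : 'I_n -> CC) :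
  (forall i, C_has_deriv (f i) z (l i)) ->
  C_has_deriv (fun w => \sum_(i < n) f i w)%R z (\sum_(i < n) l i)%R.
Proof.
elim: n f l => [|n IHn] f l df.
  rewrite big_ord0; apply: has_deriv_eq (has_deriv_const 0%R z) => w.
  by rewrite big_ord0.
rewrite big_ord_recr; apply: (has_deriv_eq (fun w => \sum_(i < n) _ + f ord_max w)%R) => [w|].
  by rewrite big_ord_recr.
by apply: has_deriv_add => //; apply: IHn.
Qed.

(** * Open sets, uniqueness of derivative sequences, real differentials *)

Lemma locally_CabsP (z : CC) (P : CC -> Prop) :
  @locally (AbsRing_UniformSpace C_AbsRing) z P <->
  exists2 d, 0 < d & forall w : CC, Cabs (w - z)%R < d -> P w.
Proof.
split=> [[d Pd]|[d d_gt0 Pd]].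
  by exists d; [exact: (cond_pos d)|move=> w w_lt; apply: Pd; rewrite CabsE in w_lt].
by exists (mkposreal _ d_gt0) => w w_lt; apply: Pd; rewrite CabsE.
Qed.

Definition C_open (U : CC -> Prop) :=
  forall z, U z -> exists2 d, 0 < d & forall w : CC, Cabs (w - z)%R < d -> U w.

Lemma Rabs_snd_le (z : CC) : Rabs (snd z) <= Cabs z.
Proof. by rewrite CabsE; apply: Rle_trans (Rmax_Cmod z); exact: Rmax_r. Qed.

Lemma Rabs_fst_le (z : CC) : Rabs (fst z) <= Cabs z.
Proof. by rewrite CabsE; apply: Rle_trans (Rmax_Cmod z); exact: Rmax_l. Qed.

Lemma open_upper_half_plane : C_open upper_half_plane.
Proof.
move=> z z_gt0; exists (snd z) => // w w_lt.
have := Rle_lt_trans _ _ _ (Rabs_snd_le (w - z)%R) w_lt.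
rewrite -[(w - z)%R]/(Cadd w (Cneg z)) /= => /Rabs_def2.
rewrite /upper_half_plane; lra.
Qed.

Lemma open_right_half_plane : C_open right_half_plane.
Proof.
move=> z z_gt0; exists (fst z) => // w w_lt.
have := Rle_lt_trans _ _ _ (Rabs_fst_le (w - z)%R) w_lt.
rewrite -[(w - z)%R]/(Cadd w (Cneg z)) /= => /Rabs_def2.
rewrite /right_half_plane; lra.
Qed.

Lemma has_deriv_ext (U : CC -> Prop) (f g : CC -> CC) (z l : CC) :
  C_open U -> U z -> (forall w, U w -> f w = g w) ->
  C_has_deriv f z l -> C_has_deriv g z l.
Proof.
move=> openU Uz fg /is_derive_C_has_deriv df; apply/is_derive_C_has_deriv.
apply: is_derive_ext_loc df; apply/locally_CabsP.
by have [d d_gt0 Ud] := openU z Uz; exists d => // w /Ud/fg.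
Qed.

(** Functions that agree on an open set have the same derivative there, so induction on the order
    applies. This is what permits differentiating the functional equation [n] times. *)
Lemma deriv_seq_uniq (U : CC -> Prop) (f g : CC -> CC) (D E : nat -> CC -> CC) :
  C_open U -> deriv_seq U f D -> deriv_seq U g E -> (forall z, U z -> f z = g z) ->
  forall n z, U z -> D n z = E n z.
Proof.
move=> openU [D0 dD] [E0 dE] fg; elim=> [|n IHn] z Uz.
  by rewrite D0 // E0 // fg.
apply: (has_deriv_uniq (E n) z); last exact: dE.
exact: (has_deriv_ext _ _ _ _ _ openU Uz IHn (dD n z Uz)).
Qed.

(** The Cauchy-Riemann criterion without coordinates: a real differential that is multiplication by
    a complex number is a complex derivative. *)
Lemma filterdiff_C_has_deriv (f : CC -> CC) (z l : CC) :
  filterdiff (fun w : R * R => f w : R * R) (locally (z : R * R))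
    (fun h : R * R => (h : CC) * l : CC)%R -> C_has_deriv f z l.
Proof.
move=> [_ fd]; apply/C_has_derivP => eps eps_gt0.
have [d fd'] := fd z (fun P H => H) (mkposreal _ eps_gt0).
exists d; first exact: (cond_pos d).
move=> h h_lt; have := fd' (z + h)%R.
have E : minus ((z + h)%R : R * R) z = h by rewrite -[LHS]/(z + h - z)%R addrC addKr.
rewrite E.
(* The product norm on the plane is Euclidean, hence the modulus. *)
have N (w : CC) : norm (w : R * R) = Cabs w.
  rewrite /norm /= /prod_norm /norm /= /abs /= CabsE /Cmod.
  by rewrite -(pow2_abs (fst w)) -(pow2_abs (snd w)).
rewrite !N -[minus _ _]/(f (z + h)%R - f z - h * l)%R; apply.
(* Balls of the product are boxes, so each coordinate of [h] is bounded by its modulus. *)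
have B (a b : R) : Rabs b <= Cabs h -> ball a d (a + b).
  move=> b_le; rewrite /ball /= /AbsRing_ball /abs /minus /plus /opp /=.
  by rewrite Rplus_comm -Rplus_assoc Rplus_opp_l Rplus_0_l; lra.
by split; apply: B; [exact: Rabs_fst_le|exact: Rabs_snd_le].
Qed.

Lemma filterdiff_pair (u v lu lv : R * R -> R) (z : R * R) :
  filterdiff u (locally z) lu -> filterdiff v (locally z) lv ->
  filterdiff (fun w => (u w, v w)) (locally z) (fun h => (lu h, lv h)).
Proof.
move=> du dv; apply: (filterdiff_comp'_2 u v pair z lu lv pair) => //.
apply: (filterdiff_ext_lin _ id); last by case.
by apply: (filterdiff_ext id); [case|exact: filterdiff_id].
Qed.

Lemma filterdiff_fst (z : R * R) : filterdiff (fst : R * R -> R) (locally z) fst.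
Proof. by apply: filterdiff_linear; exact: is_linear_fst. Qed.
Lemma filterdiff_snd (z : R * R) : filterdiff (snd : R * R -> R) (locally z) snd.
Proof. by apply: filterdiff_linear; exact: is_linear_snd. Qed.

Lemma filterdiff_Rmul (u v lu lv : R * R -> R) (z : R * R) :
  filterdiff u (locally z) lu -> filterdiff v (locally z) lv ->
  filterdiff (fun w => u w * v w) (locally z) (fun h => lu h * v z + u z * lv h).
Proof. by move=> du dv; apply: (filterdiff_mult_fct u v) => //; exact: Rmult_comm. Qed.

Lemma filterdiff_Rcomp (u lu : R * R -> R) (g : R -> R) (l : R) (z : R * R) :
  filterdiff u (locally z) lu -> is_derive g (u z) l ->
  filterdiff (fun w => g (u w)) (locally z) (fun h => lu h * l).
Proof. by move=> du dg; exact: (filterdiff_comp' u g z lu (scal^~ l)). Qed.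

(** * Derivatives of the inverse and of the principal power *)

Lemma Cabs_triangle (z w : CC) : Cabs (z + w)%R <= Cabs z + Cabs w.
Proof. by rewrite !CabsE; exact: Cmod_triangle. Qed.

Lemma CabsN (z : CC) : Cabs (- z)%R = Cabs z.
Proof. by rewrite !CabsE; exact: Cmod_opp. Qed.

Lemma Cabs_inv (z : CC) : z != 0%R -> Cabs z^-1%R = / Cabs z.
Proof.
move=> z0; have P : 0 < Cabs z by apply: sqrt_lt_R0; apply: Cnorm2_gt0; exact/eqP.
apply: (Rmult_eq_reg_r (Cabs z)); last by lra.
rewrite -CabsM mulVf // Rinv_l; last by lra.
by rewrite /Cabs /Cnorm2 /= Rmult_0_l Rplus_0_r Rmult_1_r sqrt_1.
Qed.

Lemma has_deriv_inv (z : CC) : z != 0%R ->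
  C_has_deriv (fun w => w^-1)%R z (- (z^-1 * z^-1))%R.
Proof.
move=> z0; apply/C_has_derivP => eps eps_gt0.
have a_gt0 : 0 < Cabs z by apply: sqrt_lt_R0; apply: Cnorm2_gt0; exact/eqP.
set a := Cabs z in a_gt0 *.
have a3_gt0 : 0 < a * a * a by repeat apply: Rmult_lt_0_compat.
(* The first bound keeps [|z + h|] above [a / 2]; the second then makes [|h| / (a^2 |z + h|)] at
   most [eps]. *)
exists (Rmin (a / 2) (eps * (a * a * a) / 2)).
  by apply: Rmin_pos; [lra|have := Rmult_lt_0_compat _ _ eps_gt0 a3_gt0; lra].
move=> h h_lt.
have h1 : Cabs h < a / 2 by apply: Rlt_le_trans h_lt (Rmin_l _ _).
have h2 : Cabs h < eps * (a * a * a) / 2 by apply: Rlt_le_trans h_lt (Rmin_r _ _).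
have zh : a / 2 < Cabs (z + h)%R.
  have := Cabs_triangle (z + h)%R (- h)%R.
  rewrite addrK CabsN -/a; lra.
have zh0 : (z + h)%R != 0%R.
  by apply/eqP => e; move: zh; rewrite e /Cabs /Cnorm2 /= Rmult_0_l Rplus_0_l sqrt_0; lra.
(* The remainder is exactly [h^2 / (z^2 (z + h))]. *)
have -> : ((z + h)^-1 - z^-1 - h * - (z^-1 * z^-1) = h * (z^-1 * z^-1 * (z + h)^-1) * h)%R.
  set u := ((z + h)^-1)%R; set v := (z^-1)%R.
  have uz : ((z + h) * u = 1)%R by rewrite mulfV.
  have vz : (z * v = 1)%R by rewrite mulfV.
  have ev : (v = u + h * u * v)%R.
    by rewrite -{1}[u]mulr1 -vz mulrA [(u * z)%R]mulrC -mulrDl -mulrDl uz mul1r.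
  have euv : (u - v = - (h * u * v))%R by rewrite [v in LHS]ev opprD addrA subrr sub0r.
  rewrite euv mulrN opprK addrC mulrA [(h * u * v)%R]mulrAC -mulrBr -opprB euv opprK.
  rewrite -!mulrA; congr (h * (v * _))%R.
  by rewrite [RHS]mulrCA mulrC -mulrA.
rewrite 2!CabsM; apply: Rmult_le_compat_r; first exact: sqrt_pos.
rewrite !CabsM !Cabs_inv // -/a.
set b := Cabs (z + h)%R in zh *.
have b_gt0 : 0 < b by lra.
have ab : a * a * a / 2 <= a * a * b by nra.
have -> : / a * / a * / b = / (a * a * b) by field; lra.
apply: (Rmult_le_reg_r (a * a * b)); first by nra.
rewrite Rmult_assoc Rinv_l; nra.
Qed.

(** On the right half plane the argument is [atan (y / x)], so the power has a closed form in the
    real coordinates. The chain rule gives its real differential, which turns out to be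
    multiplication by [r z^r / z]. *)
Lemma has_deriv_Cpowr (r : R) (z : CC) : right_half_plane z ->
  C_has_deriv (fun w => Cpowr w r) z (RtoC r * Cpowr z r / z)%R.
Proof.
move=> z_gt0.
pose f (w : R * R) : R * R :=
  (exp (r * ln (sqrt (fst w * fst w + snd w * snd w))) * cos (r * atan (snd w * / fst w)),
   exp (r * ln (sqrt (fst w * fst w + snd w * snd w))) * sin (r * atan (snd w * / fst w))).
have fE w : right_half_plane w -> f w = Cpowr w r.
  rewrite /right_half_plane /Cpowr /Carg /f => w_gt0.
  case: (Req_dec_T (Cnorm2 w) 0) => [e|ne] /=; first by move: e; rewrite /Cnorm2; nra.
  by case: (Rlt_dec 0 (fst w)) => [lt0|/(_ w_gt0)[]]; reflexivity.
apply: (has_deriv_ext _ f _ _ _ open_right_half_plane z_gt0 fE).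
rewrite -(fE z z_gt0); apply: filterdiff_C_has_deriv.
case: z z_gt0 => x y; rewrite /right_half_plane /= => x_gt0.
have q_gt0 : 0 < x * x + y * y by nra.
have dq : filterdiff (fun w : R * R => fst w * fst w + snd w * snd w) (locally (x, y))
    (fun h : R * R => (fst h * x + x * fst h) + (snd h * y + y * snd h)).
  apply: filterdiff_plus_fct; apply: filterdiff_Rmul;
    by [exact: filterdiff_fst|exact: filterdiff_snd].
have dmod : filterdiff (fun w : R * R => exp (r * ln (sqrt (fst w * fst w + snd w * snd w))))
    (locally (x, y)) (fun h => ((fst h * x + x * fst h) + (snd h * y + y * snd h)) *
      (r / (2 * (x * x + y * y)) * exp (r * ln (sqrt (x * x + y * y))))).
  apply: (filterdiff_Rcomp _ _ (fun t => exp (r * ln (sqrt t))) _ _ dq) => /=.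
  have s_gt0 := sqrt_lt_R0 _ q_gt0.
  auto_derive; first by split.
  (* Writing [x * x + y * y] as the square of [s] leaves a rational identity in [s]. *)
  have := sqrt_sqrt (x * x + y * y) (Rlt_le _ _ q_gt0).
  move: s_gt0; set E := exp _; set s := sqrt _ => s_gt0 <-.
  by field; lra.
have darg : filterdiff (fun w : R * R => snd w * / fst w) (locally (x, y))
    (fun h => snd h * / x + y * (fst h * (- / (x * x)))).
  apply: (filterdiff_Rmul _ (fun w => / fst w) snd _ (x, y) (filterdiff_snd _)).
  apply: (filterdiff_Rcomp _ _ Rinv _ _ (filterdiff_fst _)) => /=.
  by auto_derive; [lra|field; lra].
have dcos := filterdiff_Rcomp _ _ (fun t => cos (r * atan t)) 
  (- (r / (1 + (y * / x) * (y * / x)) * sin (r * atan (y * / x)))) _ darg.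
have dsin := filterdiff_Rcomp _ _ (fun t => sin (r * atan t)) 
  (r / (1 + (y * / x) * (y * / x)) * cos (r * atan (y * / x))) _ darg.
have t_gt0 : 0 < 1 + (y * / x) * (y * / x) by nra.
apply: (filterdiff_ext_lin _ _ _ (filterdiff_pair _ _ _ _ _ 
  (filterdiff_Rmul _ _ _ _ _ dmod (dcos _)) (filterdiff_Rmul _ _ _ _ _ dmod (dsin _)))).
- by rewrite /=; auto_derive => //; rewrite /Rsqr; field; nra.
- by rewrite /=; auto_derive => //; rewrite /Rsqr; field; nra.
case=> h k /=; rewrite /f /=.
set A := exp _; set c := cos _; set s := sin _.
rewrite -[RHS]/(Cmul (h, k) (Cmul (Cmul (RtoC r) (A * c, A * s)) (Cinv (x, y)))).
rewrite /Cmul /Cinv /Cnorm2 /=.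
by congr pair; field; repeat split; nra.
Qed.
End ComplexDerivative.

(** * The two half planes and the fixed point [i] *)

Section HalfPlanes.
Local Open Scope R_scope.

(** The real part of [z / i] is the imaginary part of [z]. *)
Lemma right_half_plane_div_i (z : CC) :
  upper_half_plane z -> right_half_plane (z * (Ci : CC)^-1)%R.
Proof.
case: z => x y; rewrite /upper_half_plane /right_half_plane /= => y_gt0.
change (0 < fst (Cmul (x, y) (Cinv Ci))); rewrite /Cmul /Cinv /Cnorm2 /=.
by rewrite (_ : _ - _ = y) //; field.
Qed.

Lemma upper_half_plane_inv (z : CC) :
  upper_half_plane z -> z != 0%R /\ upper_half_plane (- z^-1)%R.
Proof.
case: z => x y; rewrite /upper_half_plane /= => y_gt0; split.
  by apply/eqP => -[_ y0]; lra.
change (0 < snd (Cneg (Cinv (x, y)))); rewrite /Cneg /Cinv /Cnorm2 /=.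
have q_gt0 : 0 < x * x + y * y by nra.
rewrite (_ : - _ = y / (x * x + y * y)); first exact: Rdiv_lt_0_compat.
by field; lra.
Qed.

Lemma upper_half_plane_i : upper_half_plane Ci.
Proof. exact: Rlt_0_1. Qed.

Lemma Ci_neq0 : (Ci : CC) != 0%R.
Proof. by apply/eqP => -[] /R1_neq_R0. Qed.

Lemma Ci_sqr : ((Ci : CC) ^+ 2 = -1)%R.
Proof.
rewrite expr2 -[LHS]/(Cmul Ci Ci) -[RHS]/(Cneg Cone) /Cmul /Cneg /=.
by congr pair; ring.
Qed.

Lemma Ci_invN : (- (Ci : CC)^-1 = Ci)%R.
Proof.
by apply: (mulfI Ci_neq0); rewrite mulrN divff ?Ci_neq0 // -expr2 Ci_sqr.
Qed.

Lemma Cpowr_1 (r : R) : Cpowr Cone r = 1%R.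
Proof.
rewrite /Cpowr /Carg /Cabs /Cnorm2 /= Rmult_1_r Rmult_0_l Rplus_0_r sqrt_1 ln_1.
case: Req_dec_T => [/R1_neq_R0//|ne] /=.
case: (Rlt_dec 0 1) => [lt01|/(_ Rlt_0_1)//] /=.
rewrite /Rdiv Rmult_0_l atan_0 Rmult_0_r exp_0 cos_0 sin_0.
by rewrite Rmult_1_r Rmult_0_r.
Qed.

Lemma Cnat_neq0 (n : nat) : (0 < n)%N -> ((n%:R : CC) != 0)%R.
Proof.
by rewrite -CnatE => n_gt0; apply/eqP => -[]; apply: not_0_INR => n0; rewrite n0 in n_gt0.
Qed.

Lemma RtoCN (r : R) : RtoC (- r) = (- RtoC r)%R.
Proof. by rewrite -[RHS]/(Cneg _) /Cneg /= Ropp_0. Qed.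

End HalfPlanes.

(* Only now: these tactics shadow the [ring], [field] and [lra] of the standard
   library, which are the ones that work on its operations on [R]. *)
From mathcomp Require Import ring lra zify.
Import Num.Theory.

(** * Palindromic polynomials and Bernoulli numbers *)

Section Rational.
Local Open Scope ring_scope.

(** Pascal's rule summed against a weight: the common inductive step of the Chu-Vandermonde and
    Leibniz expansions. *)
Lemma sum_binS (R : comPzRingType) (n : nat) (g : nat -> nat -> R) :
  \sum_(j < n.+2) 'C(n.+1, j)%:R * g j (n.+1 - j)%N
  = \sum_(j < n.+1) 'C(n, j)%:R * (g j.+1 (n - j)%N + g j (n - j).+1).
Proof.
rewrite big_ord_recl /= bin0 subn0.
rewrite (eq_bigr (fun j : 'I_n.+1 => 'C(n, j.+1)%:R * g j.+1 (n - j)%N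
    + 'C(n, j)%:R * g j.+1 (n - j)%N)) => [|j _]; last first.
  by rewrite /bump /= add1n subSS binS natrD mulrDl.
rewrite big_split /= big_ord_recr /= bin_small // mul0r addr0.
under [RHS]eq_bigr do rewrite mulrDr.
rewrite big_split /= addrA [LHS]addrC; congr (_ + _).
rewrite [RHS]big_ord_recl /= bin0 subn0; congr (_ + _).
by apply: eq_bigr => j _; rewrite /bump /= add1n subnSK.
Qed.

(** Unsigned Lah numbers. The falling factorial replaces [(n-1)!/(j-1)!], which keeps them natural
    numbers and gives [j = 0] the right value: 1 for [n = 0], and 0 otherwise. *)
Definition lah (n j : nat) : nat := 'C(n, j) * n.-1 ^_ (n - j).

Lemma lah_fact (n j : nat) : (j <= n)%N ->
  (lah n.+1 j.+1 * (j`! * j.+1`! * (n - j)`!) = n`! * n.+1`!)%N.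
Proof.
move=> le_jn; rewrite /lah /= subSS.
have e1 : ('C(n.+1, j.+1) * (j.+1`! * (n - j)`!) = n.+1`!)%N.
  by rewrite -[RHS](@bin_fact _ j.+1) // subSS.
have e2 : (n ^_ (n - j) * j`! = n`!)%N.
  by rewrite -[RHS](ffact_fact (leq_subr j n)) subKn.
by rewrite -e1 -e2; ring.
Qed.

Lemma lah_diag (n : nat) : lah n n = 1%N.
Proof. by rewrite /lah binn subnn. Qed.

Lemma lah_small (n j : nat) : (n < j)%N -> lah n j = 0%N.
Proof. by move=> ?; rewrite /lah bin_small. Qed.

Lemma lahS0 (n : nat) : lah n.+1 0 = 0%N.
Proof. by rewrite /lah subn0 /= ffact_small // muln0. Qed.

(** Away from the boundary cases, the three Lah numbers are compared after multiplication by the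
    common denominator [j! (j+1)! (d+1)!], where [n = j + d + 1]. *)
Lemma lahS (n j : nat) :
  lah n.+1 j.+1 = (lah n j + (n + j.+1) * lah n j.+1)%N.
Proof.
case: (ltngtP j n) => [lt_jn|lt_nj|->]; last first.
- by rewrite !lah_diag lah_small // muln0.
- by rewrite !lah_small // ?muln0 // ltnW.
have [d ->] : exists d, n = (j + d).+1.
  by exists (n - j.+1)%N; rewrite -addSn subnKC.
have e0 := lah_fact (j + d).+1 j (leq_trans (leq_addr d j) (leqnSn _)).
have e1 := lah_fact (j + d) j (leq_addr d j).
have e2 : (lah (j + d).+1 j * (j`! * j.+1`! * d.+1`!)
           = j * j.+1 * ((j + d)`! * (j + d).+1`!))%N.
  (* The closed form needs a positive lower index, so [j = 0] is treated apart; both sides are then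
     0. *)
  case: j {lt_jn e0 e1} => [|j]; first by rewrite lahS0 !mul0n.
  rewrite -(lah_fact (j.+1 + d) j); last by rewrite addSn -addnS leq_addr.
  have -> : (j.+1 + d - j = d.+1)%N by lia.
  by rewrite !(factS j.+1) !(factS j); ring.
have P : (0 < j`! * j.+1`! * d.+1`!)%N by rewrite !muln_gt0 !fact_gt0.
have E : ((j + d).+1 - j = d.+1)%N by lia.
rewrite E in e0; rewrite addKn in e1.
apply/eqP; rewrite -(eqn_pmul2r P); apply/eqP.
rewrite e0 mulnDl e2.
have -> : (((j + d).+1 + j.+1) * lah (j + d).+1 j.+1 * (j`! * j.+1`! * d.+1`!)
   = ((j + d).+1 + j.+1) * d.+1 * (lah (j + d).+1 j.+1 * (j`! * j.+1`! * d`!)))%N.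
  by rewrite (factS d); ring.
by rewrite e1 !factS; ring.
Qed.

(** The Lah recurrence summed against a weight: the inductive step for rising factorials and for the
    derivatives of [f(-1/z)]. *)
Lemma sum_lahS (R : comPzRingType) (n : nat) (g : nat -> R) :
  \sum_(j < n.+2) (lah n.+1 j)%:R * g j
  = \sum_(j < n.+1) (lah n j)%:R * (g j.+1 + (n + j)%:R * g j).
Proof.
rewrite big_ord_recl lahS0 mul0r add0r.
rewrite (eq_bigr (fun j : 'I_n.+1 => (lah n j)%:R * g j.+1
    + (lah n j.+1)%:R * ((n + j.+1)%:R * g j.+1))) => [|j _]; last first.
  by rewrite lahS natrD natrM; ring.
under [RHS]eq_bigr do rewrite mulrDr.
rewrite !big_split /=; congr (_ + _).
rewrite big_ord_recr /= lah_small // mul0r addr0 [RHS]big_ord_recl /= addn0.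
(* At [j = 0] either the factor [n + 0] or the Lah number vanishes. *)
rewrite (_ : (lah n 0)%:R * _ = 0) ?add0r; last first.
  by case: n => [|n]; rewrite ?lahS0 ?mul0r // mulr0.
by apply: eq_bigr.
Qed.

(** Identifies the coefficients of the theorem with Lah numbers, over any field because both the
    rationals and [CC] need it. *)
Lemma lah_div (F : fieldType) (n j : nat) : (0 < j < n)%N -> (j - 1)`!%:R != 0 :> F ->
  'C(n, j)%:R * ((n - 1)`!%:R / (j - 1)`!%:R) = (lah n j)%:R :> F.
Proof.
case: n j => [|n] [|j] //= /[1!ltnS] lt_jn; rewrite !subn1 /= => nz.
rewrite /lah /= subSS natrM; congr (_ * _).
by rewrite -(ffact_fact (leq_subr j n)) subKn ?(ltnW lt_jn) // natrM mulfK.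
Qed.

(** * Rising factorials and the palindromic identity *)

Lemma pochS (a : rat) (n : nat) : poch a n.+1 = poch a n * (a + n%:R).
Proof. by rewrite /poch big_ord_recr. Qed.

Lemma poch0 (a : rat) : poch a 0 = 1.
Proof. by rewrite /poch big_ord0. Qed.

(** For [j > m] the factor [m - j] is no longer a natural number, but the falling factorial before
    it is already 0. *)
Lemma ffactrS (R : comPzRingType) (m j : nat) :
  (m ^_ j.+1)%:R = (m ^_ j)%:R * (m%:R - j%:R) :> R.
Proof.
rewrite ffactnSr natrM; case: (leqP j m) => [le_jm|lt_mj]; first by rewrite natrB.
by rewrite ffact_small // !mul0r.
Qed.

(** Induction on [n]: the new factor splits as [m + n = (m - j) + (n + j)], which matches the Lah
    recurrence. *)
Lemma poch_lah (m n : nat) :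
  poch m%:R n = \sum_(j < n.+1) (lah n j)%:R * (m ^_ j)%:R.
Proof.
elim: n => [|n IHn].
  by rewrite big_ord_recr big_ord0 /= lah_diag ffactn0 poch0 add0r mulr1.
rewrite pochS (sum_lahS _ _ (fun j => (m ^_ j)%:R)) IHn mulr_suml.
by apply: eq_bigr => j _; rewrite ffactrS natrD; ring.
Qed.

(** Induction on [n]: the new factor splits as [a - m + n = (a + n - j) - (m - j)], which matches
    Pascal's rule. *)
Lemma poch_vandermonde (a : rat) (m n : nat) :
  poch (a - m%:R) n
  = \sum_(j < n.+1) 'C(n, j)%:R * ((-1) ^+ j * poch a (n - j) * (m ^_ j)%:R).
Proof.
elim: n => [|n IHn].
  by rewrite big_ord_recr big_ord0 /= bin0 subn0 ffactn0 !poch0 add0r !mulr1.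
rewrite (sum_binS _ _ (fun j k => (-1) ^+ j * poch a k * (m ^_ j)%:R)).
rewrite pochS IHn mulr_suml; apply: eq_bigr => j _.
have le_jn : (j <= n)%N by rewrite -ltnS.
by rewrite pochS ffactrS exprS natrB //; ring.
Qed.

(* On ['X^m] the difference of the two sides of the theorem is
   [poch m n - poch (N - m) n], the Lah expansion minus the Vandermonde
   expansion. *)
Definition pal_defect (N n : nat) (p : {poly rat}) : rat :=
  (1 - (-1) ^+ n) * p^`(n).[1]
  + \sum_(1 <= j < n)
      'C(n, j)%:R * ((n - 1)`!%:R / (j - 1)`!%:R - (-1) ^+ j * poch N%:R (n - j))
      * p^`(j).[1]
  - poch N%:R n * p.[1].

(** The two isolated terms of the identity are the ends of one uniform sum: at [j = n] the Lah
    number and the empty product are 1, and at [j = 0] the Lah number vanishes. *)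
Lemma pal_defectE (N n : nat) (p : {poly rat}) : (0 < n)%N ->
  pal_defect N n p = \sum_(j < n.+1)
    ((lah n j)%:R - 'C(n, j)%:R * ((-1) ^+ j * poch N%:R (n - j))) * p^`(j).[1].
Proof.
case: n => // n _; rewrite /pal_defect big_ord_recr big_ord_recl /=.
rewrite lah_diag lahS0 binn bin0 subn0 subnn poch0 big_add1 /= big_mkord.
rewrite (eq_bigr (fun j : 'I_n => ((lah n.+1 j.+1)%:R - 'C(n.+1, j.+1)%:R *
  ((-1) ^+ j.+1 * poch N%:R (n.+1 - j.+1))) * p^`(j.+1).[1])) => [|j _].
  by rewrite /bump /=; ring.
by rewrite mulrBr lah_div //= ?ltnS ?subn1 // pnatr_eq0 -lt0n fact_gt0.
Qed.

Lemma horner_derivnXn (m j : nat) : (('X^m : {poly rat})^`(j)).[1] = (m ^_ j)%:R.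
Proof. by rewrite derivnXn hornerMn hornerXn expr1n. Qed.

Lemma pal_defect_Xn (N n m : nat) : (0 < n)%N ->
  pal_defect N n 'X^m = poch m%:R n - poch (N%:R - m%:R) n.
Proof.
move=> n_gt0; rewrite pal_defectE // poch_lah poch_vandermonde -sumrB.
by apply: eq_bigr => j _; rewrite horner_derivnXn; ring.
Qed.

Lemma pal_defect_lin (N n K : nat) (a : nat -> rat) (d : nat -> nat) : (0 < n)%N ->
  pal_defect N n (\sum_(k < K) a k *: 'X^(d k))
  = \sum_(k < K) a k * pal_defect N n 'X^(d k).
Proof.
move=> n_gt0; rewrite pal_defectE //.
under eq_bigr => j _ do rewrite linear_sum horner_sum mulr_sumr.
rewrite exchange_big /=; apply: eq_bigr => k _.
rewrite pal_defectE // mulr_sumr; apply: eq_bigr => j _.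
by rewrite derivnZ hornerZ mulrCA.
Qed.

(** Reversing the sum exchanges the exponents [2k] and [2M - 2k]; with symmetric coefficients the
    two Pochhammer sums are equal and cancel. *)
Lemma pal_defect0 (M n : nat) (a : nat -> rat) : (0 < n)%N ->
  (forall k, (k <= M)%N -> a (M - k)%N = a k) ->
  pal_defect (2 * M) n (\sum_(k < M.+1) a k *: 'X^(2 * k)) = 0.
Proof.
move=> n_gt0 aM; rewrite (pal_defect_lin _ _ _ a (fun k => 2 * k)%N) //.
pose S := \sum_(k < M.+1) a k * poch (2 * k)%:R n.
have Srev : S = \sum_(k < M.+1) a (M - k)%N * poch (2 * (M - k))%:R n.
  by rewrite /S (reindex_inj rev_ord_inj) /=; apply: eq_bigr => k _; rewrite subSS.
rewrite -[RHS](subrr S) {2}Srev -sumrB.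
apply: eq_bigr => k _.
have le_kM : (k <= M)%N by rewrite -ltnS.
by rewrite pal_defect_Xn // aM // mulrBr mulnBr natrB ?leq_mul.
Qed.

(** * Bernoulli numbers and Bernoulli polynomials *)

Lemma size_bernl (n : nat) : size (bernl n) = n.+1.
Proof. by elim: n => //= n IHn; rewrite size_rcons IHn. Qed.

Lemma nth_bernl (n k : nat) : (k <= n)%N -> (bernl n)`_k = bern k.
Proof.
elim: n => [|n IHn]; first by rewrite leqn0 => /eqP->.
rewrite leq_eqVlt => /orP[/eqP->//|lt_kn].
by rewrite /= nth_rcons size_bernl lt_kn IHn.
Qed.

Lemma bernS (n : nat) :
  bern n.+1 = - (n.+2%:R)^-1 * \sum_(k < n.+1) 'C(n.+2, k)%:R * bern k.
Proof.
rewrite {1}/bern /= nth_rcons size_bernl ltnn eqxx; congr (_ * _).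
by apply: eq_bigr => k _; rewrite nth_bernl // -ltnS.
Qed.

Lemma sum_bern (n : nat) :
  \sum_(k < n.+1) 'C(n.+1, k)%:R * bern k = (n == 0)%:R.
Proof.
case: n => [|n]; first by rewrite big_ord_recr big_ord0 /= add0r mul1r.
rewrite big_ord_recr /= bernS binSn -natr1 mulrA mulrN divff ?pnatr_eq0 //.
  by rewrite mulN1r subrr.
by rewrite natr1 pnatr_eq0.
Qed.

Definition bernpoly (n : nat) : {poly rat} :=
  \sum_(k < n.+1) ('C(n, k)%:R * bern k) *: 'X^(n - k).

Lemma bernpoly_at0 (n : nat) : (bernpoly n).[0] = bern n.
Proof.
rewrite /bernpoly horner_sum big_ord_recr big1 /= => [|k _].
  by rewrite add0r binn subnn !hornerE.
by rewrite hornerZ hornerXn expr0n subn_eq0 leqNgt ltn_ord mulr0.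
Qed.

(** Without its last term, the sum is the defining recurrence; hence only [n = 1] has a nonzero
    increment from 0 to 1. *)
Lemma bernpoly_at1 (n : nat) : (bernpoly n).[1] = bern n + (n == 1%N)%:R.
Proof.
rewrite /bernpoly horner_sum.
under eq_bigr => k _ do rewrite hornerZ hornerXn expr1n mulr1.
rewrite big_ord_recr /= binn mul1r addrC; congr (_ + _).
by case: n => [|n]; rewrite ?big_ord0 ?sum_bern.
Qed.

Lemma deriv_bernpoly (n : nat) : (bernpoly n.+1)^`() = n.+1%:R *: bernpoly n.
Proof.
rewrite /bernpoly big_ord_recr /= subnn derivD derivZ derivC scaler0 addr0.
rewrite linear_sum scaler_sumr; apply: eq_bigr => k _.
have le_kn : (k <= n)%N by rewrite -ltnS.
rewrite /= derivZ derivXn subSn //= -scaler_nat !scalerA; congr (_ *: _).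
have := congr1 (fun m => m%:R : rat) (mul_bin_down n.+1 k).
by rewrite /= !natrM subSn // mulrA => ->; ring.
Qed.

Lemma deriv_eq_polyC (p : {poly rat}) (c : rat) :
  p^`() = c%:P -> p = c *: 'X + (p`_0)%:P.
Proof.
move=> dp; apply/polyP => -[|i]; rewrite coefD coefZ coefX coefC /=; first by ring.
have := congr1 (fun q : {poly rat} => q`_i) dp.
rewrite /= coef_deriv coefC -[p`_i.+1 *+ _]mulr_natr addr0 => e.
have nz : i.+1%:R != 0 :> rat by rewrite pnatr_eq0.
by apply: (mulIf nz); rewrite e; case: i {e nz} => [|i] /=; rewrite ?mulr1 // mulr0 mul0r.
Qed.

(* An Appell sequence is determined by the increments [(p n).[1] - (p n).[0]]. *)
Lemma appell_inj (p q : nat -> {poly rat}) :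
  (forall n, (p n.+1)^`() = n.+1%:R *: p n) ->
  (forall n, (q n.+1)^`() = n.+1%:R *: q n) ->
  p 0%N = q 0%N ->
  (forall n, (p n).[1] - (p n).[0] = (q n).[1] - (q n).[0]) ->
  forall n, p n = q n.
Proof.
move=> dp dq pq0 pq n; elim: n => // n IHn.
have de m : (p m.+1 - q m.+1)^`() = m.+1%:R *: (p m - q m).
  by rewrite derivB dp dq scalerBr.
set c := (p n.+1 - q n.+1)`_0.
have ec : p n.+1 - q n.+1 = c%:P.
  by rewrite [LHS](deriv_eq_polyC _ 0) ?scale0r ?add0r // de IHn subrr scaler0.
(* The next difference is linear with slope [(n+2) c]; equal increments force this slope to be 0. *)
have := deriv_eq_polyC (p n.+2 - q n.+2) (n.+2%:R * c).
rewrite de ec -mul_polyC -polyCM => /(_ erefl) e2.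
have ep : p n.+2 = q n.+2 + (p n.+2 - q n.+2) by rewrite addrC subrK.
have := pq n.+2; rewrite ep e2 !(hornerD, hornerZ, hornerX, hornerC) => e3.
suff c0 : c = 0 by apply/eqP; rewrite -subr_eq0 ec c0.
have : n.+2%:R * c = 0 by move: e3; rewrite mulr1 mulr0 => e3; lra.
by move/eqP; rewrite mulf_eq0 pnatr_eq0 => /eqP.
Qed.

Lemma bernpoly0 : bernpoly 0 = 1.
Proof. by rewrite /bernpoly big_ord_recr big_ord0 /= add0r bin0 mul1r scale1r. Qed.

(** Both sides are Appell sequences starting at 1. The reflection swaps the ends 0 and 1, and at
    [n = 1], the only nonzero increment, the sign compensates. *)
Lemma bernpoly_refl (n : nat) :
  (-1) ^+ n *: (bernpoly n \Po (1 - 'X)) = bernpoly n.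
Proof.
apply: (appell_inj (fun n => (-1) ^+ n *: (bernpoly n \Po (1 - 'X)))) => {n} [n|n||n].
- rewrite derivZ deriv_comp deriv_bernpoly derivB derivX derivC sub0r mulrN1 comp_polyZ.
  by rewrite exprS scalerN !scalerA mulN1r -scaleNr; congr (_ *: _); ring.
- exact: deriv_bernpoly.
- by rewrite bernpoly0 comp_polyC scale1r.
rewrite !hornerZ !horner_comp !(hornerD, hornerN, hornerX, hornerC) subrr subr0 bernpoly_at0 bernpoly_at1.
by case: n => [|[|n]] /=; ring.
Qed.

(** At 0 the reflection formula equates [-B_n(1)] with [B_n(0)], while the two values agree for
    [n > 1]. *)
Lemma bern_odd (n : nat) : odd n -> (1 < n)%N -> bern n = 0.
Proof.
move=> odd_n n_gt1; have := congr1 (horner^~ 0) (bernpoly_refl n).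
rewrite /= hornerZ horner_comp !(hornerD, hornerN, hornerX, hornerC) subr0.
rewrite bernpoly_at0 bernpoly_at1 -signr_odd odd_n.
by rewrite (gtn_eqF n_gt1) /= expr1 => e; lra.
Qed.

(** Again two Appell sequences: in the increment on the left the values at [1/2] cancel, leaving
    [2^n] times that of [B_n], which is nonzero only for [n = 1]. *)
Lemma bernpoly_dup (n : nat) :
  2%:R ^+ n *: ((bernpoly n \Po (2%:R^-1 *: 'X)) + (bernpoly n \Po (2%:R^-1 *: ('X + 1))))
  = 2%:R *: bernpoly n.
Proof.
apply: (appell_inj
  (fun n => 2%:R ^+ n *: ((bernpoly n \Po (2%:R^-1 *: 'X))
            + (bernpoly n \Po (2%:R^-1 *: ('X + 1)))))
  (fun n => 2%:R *: bernpoly n)) => {n} [n|n||n].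
- rewrite derivZ derivD !deriv_comp deriv_bernpoly !derivZ derivD derivX derivC addr0.
  rewrite !comp_polyZ -mulrDl -scalerDr -scalerAr mulr1 !scalerA; congr (_ *: _).
  by rewrite exprS; field.
- by rewrite derivZ deriv_bernpoly !scalerA mulrC.
- by rewrite bernpoly0 !comp_polyC scale1r scaler_nat.
have e : 2%:R^-1 * (1 + 1) = 1 :> rat by [].
rewrite !(hornerD, hornerZ, horner_comp, hornerX, hornerC) e add0r mulr0 mulr1.
rewrite bernpoly_at0 bernpoly_at1.
by case: n => [|[|n]] /=; ring.
Qed.

Lemma bernpoly_half (n : nat) :
  (bernpoly n).[2%:R^-1] = (2%:R / 2%:R ^+ n - 1) * bern n.
Proof.
have := congr1 (horner^~ 0) (bernpoly_dup n).
rewrite /= !(hornerD, hornerZ, horner_comp, hornerX, hornerC) mulr0 add0r mulr1 bernpoly_at0 => e.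
have P : 2%:R ^+ n != 0 :> rat by rewrite expf_neq0.
apply: (mulfI P); have -> : 2%:R ^+ n * (bernpoly n).[2%:R^-1] = 2%:R * bern n - 2%:R ^+ n * bern n.
  by rewrite -e; ring.
by field.
Qed.

(** * The starred numbers and the coefficients of the two polynomials *)

Lemma bstarE (s : nat) : (1 < s)%N ->
  bstar s = bern s + (4%:R - 2%:R / 2%:R ^+ s) * bern s.+1 / s.+1%:R.
Proof.
move=> s_gt1.
(* Twice the expansion of [B_(s+1)(1/2)], without its last two terms [k = s] and [k = s+1], is the
   sum in [bstar s]. *)
have := bernpoly_half s.+1; rewrite /bernpoly horner_sum.
under eq_bigr => k _ do rewrite hornerZ hornerXn.
rewrite 2!big_ord_recr /= binn subnn subSnn binSn expr1 expr0 mul1r mulr1.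
rewrite (eq_bigr (fun k : 'I_s =>
    2%:R^-1 * ('C(s.+1, k)%:R * (2%:R ^+ (s - k))^-1 * bern k))) => [|k _]; last first.
  by rewrite subSn ?(ltnW (ltn_ord k)) // exprS -exprVn; ring.
rewrite -mulr_sumr.
have -> : bstar s = - (s.+1%:R)^-1 *
    \sum_(k < s) ('C(s.+1, k))%:R * (2%:R ^+ (s - k))^-1 * bern k.
  by case: s s_gt1 => [|[|s]].
set S := \sum_(k < s) _; rewrite exprS => e.
have P : 2%:R ^+ s != 0 :> rat by rewrite expf_neq0.
have nz : s.+1%:R != 0 :> rat by rewrite pnatr_eq0.
have -> : S = 2%:R * ((2%:R / (2%:R * 2%:R ^+ s) - 1) * bern s.+1 - bern s.+1
   - s.+1%:R * bern s * 2%:R^-1) by rewrite -e; field.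
by field; rewrite nat1r nz P.
Qed.

Lemma bern2 : bern 2 = 6%:R^-1.
Proof. by rewrite bernS !big_ord_recr big_ord0 /= bernS !big_ord_recr big_ord0. Qed.

Lemma bstar_even (s : nat) : ~~ odd s -> bstar s = bern s.
Proof.
case: s => [|[|s]] // even_s.
by rewrite bstarE // [bern s.+3]bern_odd ?mulr0 ?mul0r ?addr0 //= negbK.
Qed.

(** The exceptional value [1/4] at [s = 1] fits, being [(4 - 1) B_2 / 2]; for larger odd [s] the
    term [B_s] vanishes. *)
Lemma bstar_odd (s : nat) : odd s ->
  bstar s = (4%:R - 2%:R / 2%:R ^+ s) * bern s.+1 / s.+1%:R.
Proof.
case: s => [|[|s]] // odd_s; first by rewrite bern2.
by rewrite bstarE // [bern s.+2]bern_odd // add0r.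
Qed.

Definition egf_bern (k : nat) : rat := bern k / k`!%:R.

(** Subtracting the polynomial at [z/2] contributes [1 - 2^(-2k)]. The other factor arises from the
    odd index: for even [m > 0], [bstar (m-1) / (m-1)!] is [4 (1 - 2^(-m)) B_m / m!]. *)
Lemma genQ_dup_coef (s : nat) :
  genQ (2 * s) - (genQ (2 * s) \Po (2%:R^-1 *: 'X))
  = \sum_(k < s.+2) (4%:R * ((1 - (2%:R ^+ (2 * k))^-1) * egf_bern (2 * k)) *
       ((1 - (2%:R ^+ (2 * (s.+1 - k)))^-1) * egf_bern (2 * (s.+1 - k)))) *: 'X^(2 * k).
Proof.
(* The top term [k = s+1], absent from [genQ], has the factor [1 - 2^0 = 0]; it is there to make the
   sum symmetric. *)
rewrite [RHS]big_ord_recr /= subnn muln0 expr0 invr1 subrr mul0r mulr0 scale0r addr0.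
rewrite /genQ (_ : (2 * s).+1./2 = s); last by rewrite mul2n -addn1 halfD odd_double doubleK /= addn0.
rewrite linear_sum -sumrB /=; apply: eq_bigr => k _.
have le_ks : (k <= s)%N by rewrite -ltnS.
rewrite comp_polyZ comp_Xn_poly exprZn scalerA -scalerBl; congr (_ *: _).
move: (k : nat) le_ks => {}k le_ks.
have [d ->] : exists d, s = (k + d)%N by exists (s - k)%N; rewrite subnKC.
have -> : ((2 * (k + d)).+1 - 2 * k = (2 * d).+1)%N by lia.
have -> : (2 * ((k + d).+1 - k) = (2 * d).+2)%N by lia.
rewrite (bstar_even (2 * k)) ?mul2n ?odd_double // bstar_odd /= ?odd_double //.
rewrite /egf_bern (factS d.*2.+1) natrM !exprVn !exprS.
have P : 2%:R ^+ d.*2 != 0 :> rat by rewrite expf_neq0.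
have Q : 2%:R ^+ k.*2 != 0 :> rat by rewrite expf_neq0.
have f1 : (k.*2)`!%:R != 0 :> rat by rewrite pnatr_eq0 -lt0n fact_gt0.
have f2 : (d.*2.+1)`!%:R != 0 :> rat by rewrite pnatr_eq0 -lt0n fact_gt0.
have nz : (d.*2.+2)%:R != 0 :> rat by rewrite pnatr_eq0.
by field; rewrite f1 f2 P Q -natrD nz.
Qed.

Lemma ramanujanRE (s : nat) : ramanujanR s
  = \sum_(k < s.+2) (egf_bern (2 * k) * egf_bern (2 * (s.+1 - k))) *: 'X^(2 * k).
Proof.
apply: eq_bigr => k _; congr (_ *: _).
have -> : (2 * s + 2 - 2 * k = 2 * (s.+1 - k))%N by lia.
by rewrite /egf_bern mulf_div.
Qed.

Lemma ramanujanR_pal_defect (s n : nat) : (0 < n)%N ->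
  pal_defect (2 * s + 2) n (ramanujanR s) = 0.
Proof.
move=> n_gt0; rewrite ramanujanRE -mulnSr.
apply: (pal_defect0 s.+1 n (fun k => egf_bern (2 * k) * egf_bern (2 * (s.+1 - k)))) => // k le_ks.
by rewrite subKn // mulrC.
Qed.

Lemma genQ_pal_defect (s n : nat) : (0 < n)%N ->
  pal_defect (2 * s + 2) n (genQ (2 * s) - (genQ (2 * s) \Po (2%:R^-1 *: 'X))) = 0.
Proof.
move=> n_gt0; rewrite genQ_dup_coef -mulnSr.
pose c k := (1 - (2%:R ^+ (2 * k))^-1) * egf_bern (2 * k).
apply: (pal_defect0 s.+1 n (fun k => 4%:R * c k * c (s.+1 - k)%N)) => // k le_ks.
by rewrite subKn // mulrAC.
Qed.

End Rational.

(** * Derivative sequences *)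

Section DerivativeSequences.
Local Open Scope ring_scope.

Lemma deriv_seq_add (U : CC -> Prop) (f g : CC -> CC) (D E : nat -> CC -> CC) :
  deriv_seq U f D -> deriv_seq U g E ->
  deriv_seq U (fun z => f z + g z) (fun n z => D n z + E n z).
Proof.
move=> [D0 dD] [E0 dE]; split=> [z Uz|n z Uz]; first by rewrite D0 // E0.
by apply: has_deriv_add; [exact: dD|exact: dE].
Qed.

Lemma deriv_seq_scale (U : CC -> Prop) (c : CC) (f : CC -> CC) (D : nat -> CC -> CC) :
  deriv_seq U f D -> deriv_seq U (fun z => c * f z) (fun n z => c * D n z).
Proof.
move=> [D0 dD]; split=> [z Uz|n z Uz]; first by rewrite D0.
by apply: has_deriv_Cmul; exact: dD.
Qed.

Lemma deriv_seq_mul (U : CC -> Prop) (f g : CC -> CC) (D E : nat -> CC -> CC) :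
  deriv_seq U f D -> deriv_seq U g E ->
  deriv_seq U (fun z => f z * g z)
    (fun n z => \sum_(j < n.+1) 'C(n, j)%:R * (D j z * E (n - j)%N z)).
Proof.
move=> [D0 dD] [E0 dE]; split=> [z Uz|n z Uz].
  by rewrite big_ord_recr big_ord0 /= bin0 add0r mul1r D0 // E0.
rewrite (sum_binS _ _ (fun j k => D j z * E k z)).
apply: has_deriv_sum => j; apply: has_deriv_Cmul.
by apply: has_deriv_mul; [exact: dD|exact: dE].
Qed.

Lemma deriv_seq_scale_arg (U V : CC -> Prop) (c : CC) (f : CC -> CC) (D : nat -> CC -> CC) :
  (forall z, U z -> V (z * c)) -> deriv_seq V f D ->
  deriv_seq U (fun z => f (z * c)) (fun n z => c ^+ n * D n (z * c)).
Proof.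
move=> UV [D0 dD]; split=> [z Uz|n z Uz]; first by rewrite mul1r D0 //; exact: UV.
rewrite exprSr -mulrA; apply: has_deriv_Cmul.
apply: (has_deriv_comp (D n) (fun w => w * c)); first exact: dD (UV _ Uz).
have := has_deriv_mul _ _ z _ _ (has_deriv_id z) (has_deriv_const c z).
by rewrite mulr0 addr0 mul1r.
Qed.

Lemma has_deriv_invX (k : nat) (z : CC) : z != 0 ->
  C_has_deriv (fun w => w^-1 ^+ k) z (- (k%:R * z^-1 ^+ k.+1)).
Proof.
move=> z0; elim: k => [|k IHk].
  by rewrite mul0r oppr0; exact: has_deriv_const.
apply: (has_deriv_eq (fun w => w^-1 * w^-1 ^+ k)) => [w|]; first by rewrite exprS.
have := has_deriv_mul _ _ z _ _ (has_deriv_inv z z0) IHk.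
by congr C_has_deriv; rewrite !exprS -natr1; ring.
Qed.

(** With [w = -1/z] and [w' = w^2], the derivative of [w^(n+j) f^(j)(w)] is [(n+j) w^(n+1+j)
    f^(j)(w) + w^(n+j+2) f^(j+1)(w)]: the Lah recurrence. *)
Lemma deriv_seq_inv (U V : CC -> Prop) (f : CC -> CC) (D : nat -> CC -> CC) :
  (forall z, U z -> z != 0 /\ V (- z^-1)) -> deriv_seq V f D ->
  deriv_seq U (fun z => f (- z^-1)) (fun n z =>
    \sum_(j < n.+1) (lah n j)%:R * ((- z^-1) ^+ (n + j) * D j (- z^-1))).
Proof.
move=> UV [D0 dD]; split=> [z /UV[_ Vz]|n z /UV[z0 Vz]].
  by rewrite big_ord_recr big_ord0 /= lah_diag add0r !mul1r D0.
rewrite (sum_lahS _ _ (fun j => (- z^-1) ^+ (n.+1 + j) * D j (- z^-1))).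
apply: has_deriv_sum => j; apply: has_deriv_Cmul.
have dinv : C_has_deriv (fun w => - w^-1) z (z^-1 * z^-1).
  have := has_deriv_Cmul (-1) _ _ _ (has_deriv_inv z z0).
  by rewrite mulN1r opprK; apply: has_deriv_eq => w; exact: mulN1r.
have dX := has_deriv_Cmul ((-1) ^+ (n + j)) _ _ _ (has_deriv_invX (n + j) z z0).
have dXD := has_deriv_mul _ _ z _ _ dX (has_deriv_comp (D j) _ z _ _ (dD j _ Vz) dinv).
apply: (has_deriv_eq (fun w => (-1) ^+ (n + j) * w^-1 ^+ (n + j) * D j (- w^-1))) => [w|].
  by rewrite [in RHS]exprNn.
move: dXD; congr C_has_deriv.
by rewrite addnS addSn !exprS [(- z^-1) ^+ _]exprNn; ring.
Qed.

(** Here [(-1)^k (-r)_k] is the falling factorial [r (r-1) ... (r-k+1)]. *)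
Lemma deriv_seq_Cpowr (r : R) :
  deriv_seq upper_half_plane (fun z => Cpowr (z * (Ci : CC)^-1) r)
    (fun k z => (-1) ^+ k * Cpoch (RtoC (Ropp r)) k * z^-1 ^+ k * Cpowr (z * (Ci : CC)^-1) r).
Proof.
split=> [z _|k z Uz]; first by rewrite !mul1r.
have [z0 _] := upper_half_plane_inv z Uz.
have dz : C_has_deriv (fun w => w * (Ci : CC)^-1) z (Ci : CC)^-1.
  have := has_deriv_mul _ _ z _ _ (has_deriv_id z) (has_deriv_const (Ci : CC)^-1 z).
  by rewrite mulr0 addr0 mul1r.
have dP := has_deriv_comp (fun w => Cpowr w r) _ z _ _
  (has_deriv_Cpowr r _ (right_half_plane_div_i z Uz)) dz.
have dX := has_deriv_Cmul ((-1) ^+ k * Cpoch (RtoC (Ropp r)) k) _ _ _ (has_deriv_invX k z z0).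
have := has_deriv_mul _ _ z _ _ dX dP; congr C_has_deriv.
rewrite /= CnatE RtoCN !CringE !exprS.
by field; rewrite z0 Ci_neq0.
Qed.

End DerivativeSequences.

(** * The differentiated functional equation at [i] *)

Section ModularRelation.
Local Open Scope ring_scope.

Lemma modular_relation_derivatives (r : R) (eps : CC) (F S : CC -> CC)
    (DF DS : nat -> CC -> CC) :
  deriv_seq upper_half_plane F DF -> deriv_seq right_half_plane S DS ->
  (forall z : CC, upper_half_plane z ->
     F (- z^-1) - eps * Cpowr (z / Ci) r * F z = S (z / Ci)) ->
  forall n, \sum_(j < n.+1)
      ((lah n j)%:R * (-1) ^+ n
       - eps * ('C(n, j)%:R * ((-1) ^+ (n - j) * Cpoch (RtoC (Ropp r)) (n - j))))
      * (Ci : CC)^-1 ^+ (n - j) * DF j Ci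
    = (Ci : CC)^-1 ^+ n * DS n 1.
Proof.
move=> dF dS FS n; have i0 := Ci_neq0.
have d1 := deriv_seq_inv _ _ _ _ upper_half_plane_inv dF.
have d2 := deriv_seq_scale _ (- eps) _ _ (deriv_seq_mul _ _ _ _ _ dF (deriv_seq_Cpowr r)).
have d3 := deriv_seq_scale_arg _ _ _ _ _ right_half_plane_div_i dS.
have FS' z : upper_half_plane z ->
    F (- z^-1) + - eps * (F z * Cpowr (z * (Ci : CC)^-1) r) = S (z * (Ci : CC)^-1).
  by move=> /FS <-; ring.
(* Both sides of the functional equation have explicit derivative sequences, which agree at [i] by
   uniqueness. *)
have := deriv_seq_uniq _ _ _ _ _ open_upper_half_plane (deriv_seq_add _ _ _ _ _ d1 d2) d3
  FS' n Ci upper_half_plane_i.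
rewrite divff // Cpowr_1 => <-.
rewrite Ci_invN mulr_sumr -big_split; apply: eq_bigr => j _ /=.
have le_jn : (j <= n)%N by rewrite -ltnS.
(* Since [n + j = 2n - (n - j)] and [i^2 = -1]. *)
have -> : (Ci : CC) ^+ (n + j) = (-1) ^+ n * (Ci : CC)^-1 ^+ (n - j).
  have P : (Ci : CC) ^+ (n - j) != 0 by rewrite expf_neq0.
  apply: (mulIf P); rewrite -exprD -mulrA -exprMn mulVf // expr1n mulr1.
  by rewrite -Ci_sqr -exprM; congr (_ ^+ _); lia.
by ring.
Qed.

End ModularRelation.

Theorem theorem7 :
  (* (a) *)
  (forall s n : nat, (1 <= n)%N ->
     ((1 - (-1) ^+ n) * (ramanujanR s)^`(n).[1]
      + \sum_(1 <= j < n)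
          ('C(n, j))%:R * (((n - 1)`!)%:R / ((j - 1)`!)%:R
                           - (-1) ^+ j * poch (2 * s + 2)%N%:R (n - j))
          * (ramanujanR s)^`(j).[1]
      = poch (2 * s + 2)%N%:R n * (ramanujanR s).[1])%R) /\
  (* (b) *)
  (forall s n : nat, (1 <= s)%N -> (1 <= n)%N ->
     let T : {poly rat} := (genQ (2 * s) - (genQ (2 * s) \Po ((2%:R)^-1 *: 'X)))%R in
     ((1 - (-1) ^+ n) * T^`(n).[1]
      + \sum_(1 <= j < n)
          ('C(n, j))%:R * (((n - 1)`!)%:R / ((j - 1)`!)%:R
                           - (-1) ^+ j * poch (2 * s + 2)%N%:R (n - j))
          * T^`(j).[1]
      = poch (2 * s + 2)%N%:R n * T.[1])%R) /\
  (* (c) *)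
  (forall (r : R) (delta : Z) (F S : CC -> CC) (DF DS : nat -> CC -> CC),
     holomorphic_on upper_half_plane F ->
     holomorphic_on right_half_plane S ->
     deriv_seq upper_half_plane F DF ->
     deriv_seq right_half_plane S DS ->
     (forall z, upper_half_plane z ->
        (F (- Cone / z) - Cm1powZ delta * Cpowr (z / Ci) r * F z = S (z / Ci))%C) ->
     forall n : nat, (1 <= n)%N ->
       ((Cpow (- Cone) n - Cm1powZ delta) * DF n Ci
        - Cm1powZ delta * Cpoch (RtoC (Ropp r)) n * Cpow Ci n * F Ci
        + Csum_range 1 n (fun j =>
            Cnat 'C(n, j)
            * (Cpow (- Cone) n * Cnat ((n - 1)`!) / Cnat ((j - 1)`!)
               - Cm1powZ delta * Cpow (- Cone) (n - j) * Cpoch (RtoC (Ropp r)) (n - j))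
            * Cinv (Cpow Ci (n - j)) * DF j Ci)
        = Cinv (Cpow Ci n) * DS n Cone)%C).
Proof.
split; [|split] => [s n n_gt0|s n _ n_gt0 T|r delta F S DF DS _ _ dF dS FS n n_gt0].
- by apply/eqP; rewrite -subr_eq0; apply/eqP/ramanujanR_pal_defect.
- by apply/eqP; rewrite -subr_eq0; apply/eqP/genQ_pal_defect.
have FS' (z : CC) : upper_half_plane z ->
    (F (- z^-1) - Cm1powZ delta * Cpowr (z / Ci) r * F z = S (z / Ci))%R.
  by move=> /FS <-; rewrite !CringE mulN1r.
have /esym := modular_relation_derivatives r (Cm1powZ delta) F S DF DS dF dS FS' n.
rewrite !CringE !CpowE !CnatE -exprVn => ->.
have p0 : Cpoch (RtoC (Ropp r)) 0 = 1%R by [].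
(* The Pochhammer symbol is abstracted, keeping its value at 0, so that simplification does not
   unfold it. *)
move: (Cpoch (RtoC (Ropp r))) p0 => p p0.
case: n n_gt0 => // n _.
(* The ends [j = 0] and [j = n] of the uniform sum become the separate terms in [F(i)] and
   [F^(n)(i)]. *)
rewrite /Csum_range CsumE subSS subn0 [in RHS]big_ord_recr [in RHS]big_ord_recl /=.
rewrite lahS0 lah_diag bin0 binn subnn subn0 p0 dF.1 //; last exact: upper_half_plane_i.
rewrite (eq_bigr (fun i : 'I_n => (((lah n.+1 (bump 0 i))%:R * (-1) ^+ n.+1 -
    Cm1powZ delta * ('C(n.+1, bump 0 i)%:R *
      ((-1) ^+ (n.+1 - bump 0 i) * p (n.+1 - bump 0 i)%N))) *
    (Ci : CC)^-1 ^+ (n.+1 - bump 0 i) * DF (bump 0 i) Ci)%R)) => [|i _].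
  (* The statement has [i^n] beside [F(i)] where the uniform sum has [(-1)^n i^(-n)]. *)
  have e : ((Ci : CC) ^+ n.+1 = (-1) ^+ n.+1 * (Ci : CC)^-1 ^+ n.+1)%R.
    by rewrite -exprMn mulN1r Ci_invN.
  rewrite e mul0r sub0r !mul1r expr0 !mulr1 [RHS]addrC addrA !mulNr.
  by congr (_ - _ + _)%R; rewrite !mulrA [(_ * p _ * _)%R]mulrAC.
rewrite !CringE !CpowE !CnatE exprVn -(@lah_div CC) ?add1n; last first.
- by rewrite Cnat_neq0 // fact_gt0.
- by rewrite /= ltnS ltn_ord.
by rewrite /bump /= !add1n [in RHS](subn1 n.+1) /=; ring.
Qed.
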